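(* Let $G$ be a finite simple graph without isolated vertices, with maximum degree $\Delta$ and $m$ edges, and let $a>0$ be a real number. Then $$ISD_a(G) + M_1^{a+1}(G) \le \Big(2\Delta^a + \frac{1}{2\Delta^a}\Big) m,$$ and equality is attained if and only if $G$ is regular.
   Context: Graphs are undirected, finite, nonempty, simple (no loops, no multiple edges), without isolated vertices, and not necessarily connected. $d_u$ denotes the degree of the vertex $u$, and $uv$ denotes the (unordered) edge joining $u$ and $v$; sums over $uv\in E(G)$ run once over each edge. For $a\in\mathbb{R}$ the variable inverse sum deg index is $$ISD_a(G)=\sum_{uv\in E(G)}\frac{1}{d_u^a+d_v^a}.$$ For $b\in\mathbb{R}$ the variable first Zagreb index is $$M_1^{b}(G)=\sum_{u\in V(G)}d_u^{b}$$ (the superscript $b$ is a parameter, not a power). A graph is regular if all its vertices have the same degree. *)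

(* Defs.v *)
From mathcomp Require Import all_boot all_order all_algebra.
From mathcomp Require Import reals exp.

Set Implicit Arguments.
Unset Strict Implicit.
Unset Printing Implicit Defensive.

Import GRing.Theory Num.Theory.
Local Open Scope ring_scope.

Record sgraph := SGraph {
  vertex :> finType;
  adj : rel vertex;
  adj_sym : symmetric adj;
  adj_irr : irreflexive adj
}.

(* The edge uv is the two-element set [set u; v], so that sums over
   [edges G] count each unordered edge once. *)
Definition edges (G : sgraph) : {set {set G}} :=
  [set A | [exists u : G, exists v : G, adj u v && (A == [set u; v])]].

Definition deg (G : sgraph) (u : G) : nat := #|[set v : G | adj u v]|.

Definition maxdeg (G : sgraph) : nat := \max_(u : G) deg u.

Definition no_isolated (G : sgraph) : Prop := forall u : G, (0 < deg u)%N.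

Definition regular (G : sgraph) : Prop := forall u v : G, deg u = deg v.

(* On an edge A = [set u; v] the inner sum is deg u `^ a + deg v `^ a, since
   u and v are distinct. *)
Definition ISD (R : realType) (a : R) (G : sgraph) : R :=
  \sum_(A in edges G) (\sum_(u in A) (deg u)%:R `^ a)^-1.

Definition M1 (R : realType) (b : R) (G : sgraph) : R :=
  \sum_(u : G) (deg u)%:R `^ b.

(* Main.v *)
Require Import Defs.
From mathcomp Require Import all_boot all_order all_algebra.
From mathcomp Require Import reals exp.
From mathcomp Require Import ring lra.

Set Implicit Arguments.
Unset Strict Implicit.
Unset Printing Implicit Defensive.

Import Order.TTheory GRing.Theory Num.Theory.
Local Open Scope ring_scope.

(** Give each edge [uv] the weight [x = deg u `^ a + deg v `^ a]. Counting the
    pairs (vertex, incident edge) in two ways turns [M1 (a + 1) G], which is the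
    sum over vertices of [deg u * deg u `^ a], into the sum of the weights
    ([sum_edges_exchange]); so [ISD + M1] is the sum of [x + x^-1] over the
    edges. As there are no isolated vertices and [a > 0], every weight lies
    between [1] and [2 * D `^ a], where [x + x^-1] is strictly increasing
    ([leif_addV]), so each of the [m] terms is at most its value at
    [2 * D `^ a].

    Equality holds iff every edge has weight [2 * D `^ a], that is, iff both
    ends of every edge have maximum degree. Since every vertex lies on some
    edge, this says that all degrees are equal. The equality case is carried
    along with each inequality through [_ <= _ ?= iff _]. *)

Lemma edgesP (G : sgraph) (A : {set G}) :
  reflect (exists u v : G, adj u v /\ A = [set u; v]) (A \in edges G).
Proof.
rewrite inE; apply: (iffP existsP) => [[u /existsP[v /andP[uv /eqP ->]]]|].
  by exists u, v.
by move=> [u [v [uv ->]]]; exists u; apply/existsP; exists v; rewrite uv /=.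
Qed.

Lemma adj_neq (G : sgraph) (u v : G) : adj u v -> u != v.
Proof. by apply: contraTneq => ->; rewrite adj_irr. Qed.

(** The map [v |-> uv] is a bijection from the neighbours of [u] to the edges
    through [u]. *)
Lemma card_incident_edges (G : sgraph) (u : G) :
  #|[set A in edges G | u \in A]| = deg u.
Proof.
have -> : [set A in edges G | u \in A] =
          [set [set u; v] | v in [set v : G | adj u v]].
  apply/setP => A; rewrite inE; apply/andP/imsetP.
    move=> [/edgesP[x [y [xy ->]]]]; rewrite !inE => /orP[] /eqP ->.
      by exists y; rewrite ?inE.
    by exists x; rewrite 1?setUC // inE adj_sym.
  move=> [v]; rewrite inE => uv ->; split; last by rewrite !inE eqxx.
  by apply/edgesP; exists u, v.
rewrite card_in_imset // => v w; rewrite !inE => uv _ E.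
have : v \in [set u; w] by rewrite -E !inE eqxx orbT.
by rewrite !inE eq_sym (negPf (adj_neq uv)) => /eqP.
Qed.

(** Double counting of incident pairs: the term [w u] occurs once for each edge
    through [u]. *)
Lemma sum_edges_exchange (V : nmodType) (G : sgraph) (w : G -> V) :
  \sum_(A in edges G) \sum_(u in A) w u = \sum_(u : G) w u *+ deg u.
Proof.
rewrite (exchange_big_dep predT) //=; apply: eq_bigr => u _.
rewrite -card_incident_edges sumr_const; congr (_ *+ _).
by apply: eq_card => A; rewrite [RHS]inE.
Qed.

(** If [x < y] then [(y + y^-1) - (x + x^-1)] is [(y - x) * (1 - (x * y)^-1)],
    and [x * y > 1]. *)
Lemma leif_addV (R : realFieldType) (x y : R) :
  1 <= x -> x <= y -> x + x^-1 <= y + y^-1 ?= iff (x == y).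
Proof.
move=> x1; rewrite le_eqVlt => /predU1P[-> | xy].
  by split; rewrite ?lexx ?eqxx.
suff lt : x + x^-1 < y + y^-1.
  by split; [exact: ltW | rewrite (lt_eqF lt) (lt_eqF xy)].
have x0 : 0 < x by lra.
have y0 : 0 < y by lra.
rewrite -subr_gt0.
have -> : y + y^-1 - (x + x^-1) = (y - x) * (1 - (x * y)^-1).
  by field; rewrite !gt_eqF.
apply: mulr_gt0; rewrite subr_gt0 //.
rewrite invf_lt1 ?mulr_gt0 //; nra.
Qed.

Lemma deg_le_maxdeg (G : sgraph) (u : G) : (deg u <= maxdeg G)%N.
Proof. exact: (leq_bigmax u). Qed.

Lemma leif_deg_powR (R : realType) (G : sgraph) (a : R) (u : G) : 0 < a ->
  (deg u)%:R `^ a <= (maxdeg G)%:R `^ a ?= iff (deg u == maxdeg G).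
Proof.
move=> a0; split.
  apply: (ge0_ler_powR (ltW a0)); rewrite ?nnegrE ?ler0n //.
  by rewrite ler_nat deg_le_maxdeg.
apply/eqP/eqP => [|-> //].
move=> eq_powR; apply/eqP; rewrite -(eqr_nat R); apply/eqP.
by apply: (powR_injective a0) eq_powR; rewrite nnegrE ler0n.
Qed.

Lemma leif_edge_weight (R : realType) (G : sgraph) (a : R) (A : {set G}) :
    0 < a -> A \in edges G ->
  \sum_(u in A) (deg u)%:R `^ a <= 2 * (maxdeg G)%:R `^ a
    ?= iff [forall u in A, deg u == maxdeg G].
Proof.
move=> a0 /edgesP[x [y [xy ->]]].
(* An edge has two distinct ends, so the bound is also a sum over the edge. *)
have -> : 2 * (maxdeg G)%:R `^ a = \sum_(u in [set x; y]) (maxdeg G)%:R `^ a.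
  by rewrite sumr_const cards2 (adj_neq xy) mulr_natl.
by apply: leif_sum => u _; apply: leif_deg_powR.
Qed.

Lemma edge_weight_ge1 (R : realType) (G : sgraph) (a : R) (A : {set G}) :
    no_isolated G -> 0 < a -> A \in edges G ->
  1 <= \sum_(u in A) (deg u)%:R `^ a.
Proof.
move=> noiso a0 /edgesP[x [y [_ ->]]].
rewrite (bigD1 x) ?inE ?eqxx //= -[leLHS]addr0 lerD //.
  have one_powR : 1 `^ a = 1 :> R by rewrite powR1.
  by rewrite -[leLHS]one_powR; apply: (ge0_ler_powR (ltW a0));
    rewrite ?nnegrE ?ler0n ?ler01 ?ler1n ?noiso.
by apply: sumr_ge0 => u _; apply: powR_ge0.
Qed.

(** The right side is the equality condition that comes out of summing over
    edges; it constrains every vertex because every vertex lies on an edge. *)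
Lemma regular_edgesP (G : sgraph) : (0 < #|G|)%N -> no_isolated G ->
  regular G <->
  [forall (A | A \in edges G), [forall u in A, deg u == maxdeg G]].
Proof.
move=> G0 noiso; split=> [reg | /forall_inP max].
  apply/forall_inP => A _; apply/forall_inP => u _.
  have [v vmax] := bigop.eq_bigmax (@deg G) G0.
  by rewrite /maxdeg vmax (reg u v).
suff degE (u : G) : deg u = maxdeg G by move=> u v; rewrite !degE.
have /card_gt0P[v] := noiso u; rewrite inE => uv.
have /max/forall_inP maxuv : [set u; v] \in edges G.
  by apply/edgesP; exists u, v.
by apply/eqP/maxuv; rewrite !inE eqxx.
Qed.

Lemma ISD_add_M1 (R : realType) (G : sgraph) (a : R) : 0 < a ->
  let x (A : {set G}) : R := \sum_(u in A) (deg u)%:R `^ a in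
  ISD a G + M1 (a + 1) G = \sum_(A in edges G) (x A + (x A)^-1).
Proof.
move=> a0 x; rewrite big_split /= addrC sum_edges_exchange; congr (_ + _).
apply: eq_bigr => u _; rewrite powRD ?powRr1 ?mulr_natr //.
by rewrite gt_eqF // addr_gt0.
Qed.

Theorem theorem8 (R : realType) (G : sgraph) (a : R)
    (G_nonempty : (0 < #|G|)%N) (G_noiso : no_isolated G) (a_gt0 : 0 < a) :
  let D : R := (maxdeg G)%:R in
  let m : R := #|edges G|%:R in
  ISD a G + M1 (a + 1) G <= (2 * D `^ a + 1 / (2 * D `^ a)) * m
  /\ (ISD a G + M1 (a + 1) G = (2 * D `^ a + 1 / (2 * D `^ a)) * m
      <-> regular G).
Proof.
move=> D m.
suff [le eq] : ISD a G + M1 (a + 1) G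
    <= (2 * D `^ a + 1 / (2 * D `^ a)) * m
    ?= iff [forall (A | A \in edges G), [forall u in A, deg u == maxdeg G]].
  split=> //; rewrite regular_edgesP // -eq.
  by split=> /eqP.
rewrite ISD_add_M1 // div1r mulr_natr -sumr_const.
apply: leif_sum => A edgeA.
have wt := leif_edge_weight a_gt0 edgeA.
rewrite -(eq_leif wt).
by apply: leif_addV; [exact: edge_weight_ge1 | exact: wt].
Qed.
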